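(* There exists an oriented knot $K_2$ such that $v_3(K_2)(-1,1)=v_3(\mathrm{unknot})(-1,1)$, whereas $v_3(K_2)(t,x)\neq v_3(\mathrm{unknot})(t,x)$ as Laurent polynomials in $t,x$.
   Context: Knots and links are oriented and lie in $\mathbb{R}^3$. For an oriented link $L$, $\mathcal{H}^{i,j}(L)$ denotes the Khovanov homology group (with $\mathbb{Z}$ coefficients) in homological degree $i$ and quantum degree $j$, with the grading convention $\sum_{i,j}(-1)^i q^j\,\mathrm{rank}\,\mathcal{H}^{i,j}(L) = J_L(q)$, where $J_L(q)\in\mathbb{Z}[q,q^{-1}]$ is the unnormalized Jones polynomial determined by $J_{\mathrm{unknot}}(q)=q+q^{-1}$ and $q^{-2}J_{L_+}(q)-q^{2}J_{L_-}(q)=(q^{-1}-q)J_{L_0}(q)$ for links $L_+,L_-,L_0$ that are identical outside a ball, in which they are respectively a positive crossing, a negative crossing, and the oriented smoothing of that crossing. The Khovanov polynomial is $Kh(L)(t,q)=\sum_{i,j} t^i q^j\,\mathrm{rank}\,\mathcal{H}^{i,j}(L)$. Substitute $q = x e^{y}$ and expand $Kh(L)(t,xe^y)$ as a power series in $y$; for an integer $n\ge 0$, $v_n(L)(t,x)$ is the coefficient of $y^n$, a Laurent polynomial in $t,x$ with rational coefficients. $v_n(L)(-1,1)$ is its value at $t=-1$, $x=1$. *)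

(* Defs.v *)
From HB Require Import structures.
From mathcomp Require Import all_boot all_order all_algebra.
From mathcomp Require Import generic_quotient ring_quotient.
From mathcomp Require Import finmap boolp classical_sets reals.
From mathcomp Require Import monalg.
From mathcomp Require Import ring.

Set Implicit Arguments.
Unset Strict Implicit.
Unset Printing Implicit Defensive.

Import Order.TTheory GRing.Theory Num.Theory.
Local Open Scope ring_scope.

(** * Rank of an abelian group *)

Definition zindep (A : zmodType) (r : nat) (f : 'I_r -> A) : Prop :=
  forall c : 'I_r -> int, \sum_i f i *~ c i = 0 -> forall i, c i = 0.

Definition has_rank (A : zmodType) (r : nat) : Prop :=
  (exists f : 'I_r -> A, zindep f) /\ ~ (exists f : 'I_r.+1 -> A, zindep f).

(** The junk value [0] is taken only by groups of infinite rank. *)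
Definition zrank (A : zmodType) : nat := xget 0%N [set r | has_rank A r]%classic.

(** * Oriented link diagrams *)

(** A crossing is recorded by the four arcs meeting there (incoming and
    outgoing, on the under- and on the overstrand) and by its sign.  Going
    counterclockwise from the incoming underarc one meets
    [uin], [oout], [uout], [oin] if the crossing is positive and
    [uin], [oin], [uout], [oout] if it is negative. *)
Record crossing (m : nat) : Type := Crossing {
  uin : 'I_m;
  uout : 'I_m;
  oin : 'I_m;
  oout : 'I_m;
  positive : bool
}.

(** Arcs run from one crossing passage to the next; an arc which occurs in no
    crossing is a closed component without crossings. *)
Record link_diagram : Type := LinkDiagram {
  narcs : nat;
  ncross : nat;
  cross : 'I_ncross -> crossing narcs
}.

(** * The Khovanov complex, over the integers *)

Section KhovanovComplex.
Variable D : link_diagram.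
Local Notation arc := 'I_(narcs D).
Local Notation vertex := {ffun 'I_(ncross D) -> bool}.

(** The pairs of arcs joined by the 0-smoothing ([b = false]) or by the
    1-smoothing ([b = true]).  The oriented smoothing is the 0-smoothing of a
    positive crossing and the 1-smoothing of a negative one. *)
Definition smoothing (m : nat) (b : bool) (c : crossing m) : seq ('I_m * 'I_m) :=
  if b (+) positive c then [:: (uin c, oout c); (oin c, uout c)]
  else [:: (uin c, oin c); (uout c, oout c)].

Definition joined (v : vertex) : rel arc := fun e f =>
  [exists a, ((e, f) \in smoothing (v a) (cross a))
          || ((f, e) \in smoothing (v a) (cross a))].

(** The circles of the complete smoothing [v] are the classes of this relation. *)
Definition same_circle (v : vertex) : rel arc := connect (joined v).

(** A generator of the complex is a vertex of the cube of smoothings together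
    with a label [v_+] ([true]) or [v_-] ([false]) on each of its circles; a
    labelling of the circles is given as a labelling of the arcs which is
    constant on each circle. *)
Definition is_gen : pred (vertex * {ffun arc -> bool}) := fun x =>
  [forall e, forall f, same_circle x.1 e f ==> (x.2 e == x.2 f)].

Definition gen : Type := {x : vertex * {ffun arc -> bool} | is_gen x}.
HB.instance Definition _ := Finite.on gen.

Definition npos : nat := #|[set a : 'I_(ncross D) | positive (cross a)]|.
Definition nneg : nat := #|[set a : 'I_(ncross D) | ~~ positive (cross a)]|.

Definition height (v : vertex) : nat := #|[set a | v a]|.

Definition label_degree (x : gen) : int :=
  \sum_(e in roots (joined (val x).1)) (if (val x).2 e then 1 else -1).

Definition bidegree (x : gen) : int * int :=
  ((height (val x).1)%:Z - nneg%:Z,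
   label_degree x + (height (val x).1)%:Z + npos%:Z - (nneg.*2)%:Z).

(** Coefficients of the multiplication [m] and of the comultiplication [Delta]
    of the Frobenius algebra spanned by [v_+] and [v_-]:
    [m(v_+ v_+) = v_+], [m(v_+ v_-) = m(v_- v_+) = v_-], [m(v_- v_-) = 0],
    [Delta v_+ = v_+ v_- + v_- v_+], [Delta v_- = v_- v_-]. *)
Definition mult_coef (x y z : bool) : bool :=
  (x || y) && (z == (x && y)).
Definition comult_coef (x y z : bool) : bool :=
  if x then y != z else ~~ y && ~~ z.

Definition cube_edge (a : 'I_(ncross D)) (v w : vertex) : bool :=
  [&& ~~ v a, w a & [forall b, (b != a) ==> (v b == w b)]].

(** In both smoothings of a crossing [c] one of the two local strands contains
    [uin c] and the other one [uout c].  The last value [false] is never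
    reached for a planar diagram. *)
Definition local_coef (a : 'I_(ncross D)) (x y : gen) : bool :=
  let c := cross a in
  let v := (val x).1 in let w := (val y).1 in
  let s := (val x).2 in let t := (val y).2 in
  if ~~ same_circle v (uin c) (uout c) then
    mult_coef (s (uin c)) (s (uout c)) (t (uin c))
  else if ~~ same_circle w (uin c) (uout c) then
    comult_coef (s (uin c)) (t (uin c)) (t (uout c))
  else false.

Definition unchanged_elsewhere (a : 'I_(ncross D)) (x y : gen) : bool :=
  [forall e, [|| same_circle (val x).1 e (uin (cross a)),
                 same_circle (val x).1 e (uout (cross a))
               | (val x).2 e == (val y).2 e]].

Definition edge_sign (a : 'I_(ncross D)) (v : vertex) : int :=
  (-1) ^+ #|[set b : 'I_(ncross D) | (b < a)%N && v b]|.

(** Coefficient of [y] in the differential of [x]; at most one [a] contributes. *)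
Definition incidence (x y : gen) : int :=
  \sum_(a | cube_edge a (val x).1 (val y).1 && unchanged_elsewhere a x y)
    edge_sign a (val x).1 * (local_coef a x y)%:R.

Local Notation chain := {ffun gen -> int}.

Definition kh_diff (f : chain) : chain :=
  [ffun y => \sum_x f x * incidence x y].

Definition homogeneous (p : int * int) (f : chain) : bool :=
  [forall x, (f x != 0) ==> (bidegree x == p)].

Lemma kh_diffB : {morph kh_diff : f g / f - g}.
Proof.
move=> f g; apply/ffunP => y; rewrite !ffunE -sumrB.
by apply: eq_bigr => x _; rewrite !ffunE mulrBl.
Qed.

Lemma kh_diff0 : kh_diff 0 = 0.
Proof. by have := kh_diffB 0 0; rewrite !subrr. Qed.

Lemma homogeneous0 p : homogeneous p 0.
Proof. by apply/forallP => x; rewrite ffunE eqxx. Qed.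

Lemma homogeneousB p f g :
  homogeneous p f -> homogeneous p g -> homogeneous p (f - g).
Proof.
move=> /forallP hf /forallP hg; apply/forallP => x; apply/implyP.
rewrite !ffunE; have [fx0|fx _] := eqVneq (f x) 0; last exact: (implyP (hf x)).
by rewrite fx0 add0r oppr_eq0 => gx; apply: implyP gx.
Qed.

Section Homology.
Variable p : int * int.

Definition is_cycle : {pred chain} :=
  [pred f : chain | homogeneous p f && (kh_diff f == 0)].

Lemma is_cycle_closed : zmod_closed is_cycle.
Proof.
split; first by rewrite inE homogeneous0 kh_diff0 eqxx.
move=> f g /andP[hf /eqP df] /andP[hg /eqP dg].
by rewrite inE homogeneousB //= kh_diffB df dg subrr.
Qed.
HB.instance Definition _ :=
  GRing.isZmodClosed.Build chain is_cycle is_cycle_closed.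

Record cycle : Type := Cycle { cycle_val : chain; _ : cycle_val \in is_cycle }.
HB.instance Definition _ := [isSub for cycle_val].
HB.instance Definition _ := [Choice of cycle by <:].
HB.instance Definition _ := [SubChoice_isSubZmodule of cycle by <:].

(** For a planar diagram [kh_diff \o kh_diff = 0], so that these are all the
    values of [kh_diff] on the chains of bidegree [(p.1 - 1, p.2)]. *)
Definition is_boundary : {pred cycle} :=
  [pred z : cycle | `[< exists2 g : chain,
     homogeneous (p.1 - 1, p.2) g & kh_diff g = val z >]].

Lemma is_boundary_closed : zmod_closed is_boundary.
Proof.
split.
  by apply/asboolP; exists 0; rewrite ?homogeneous0 // kh_diff0 raddf0.
move=> y z /asboolP[f hf df] /asboolP[g hg dg].
apply/asboolP; exists (f - g); first exact: homogeneousB.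
by rewrite kh_diffB df dg raddfB.
Qed.
HB.instance Definition _ :=
  GRing.isZmodClosed.Build cycle is_boundary is_boundary_closed.

Definition khovanov_homology : zmodType := Quotient.quot is_boundary.

End Homology.

End KhovanovComplex.

(** * The Khovanov polynomial and its expansion *)

(** The monomial of exponent [(i, j)] is [t^i q^j] (or [t^i x^j]). *)
Definition laurent : Type := {malg rat[(int * int)%type]}.

Definition laurent_eval (P : laurent) (t x : rat) : rat :=
  \sum_(p <- msupp P) P@_p * t ^ p.1 * x ^ p.2.

(** The homology vanishes in the bidegrees of no generator. *)
Definition khovanov_poly (D : link_diagram) : laurent :=
  \sum_(p <- undup [seq bidegree x | x : gen D])
    << (zrank (khovanov_homology D p))%:R *g p >>.

(** Coefficient of [y^n] in the formal power series [e^(j y) = (e^y)^j]. *)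
Definition exp_coef (j : int) (n : nat) : rat := j%:~R ^+ n / n`!%:R.

Lemma exp_coefD (i j : int) (n : nat) :
  exp_coef (i + j) n = \sum_(k < n.+1) exp_coef i (n - k) * exp_coef j k.
Proof.
rewrite /exp_coef intrD exprDn mulr_suml; apply: eq_bigr => k _.
have fact_neq0 m : m`!%:R != 0 :> rat by rewrite pnatr_eq0 -lt0n fact_gt0.
rewrite -mulr_natr -(@bin_fact n k) ?natrM; last by rewrite -ltnS.
have bin_neq0 : 'C(n, k)%:R != 0 :> rat.
  by rewrite pnatr_eq0 -lt0n bin_gt0 -ltnS.
by field; rewrite !fact_neq0.
Qed.

(** Coefficient of [y^n] in [P(t, x e^y)]. *)
Definition expansion_coef (P : laurent) (n : nat) : laurent :=
  \sum_(p <- msupp P) << P@_p * exp_coef p.2 n *g p >>.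

Definition kh_v (n : nat) (D : link_diagram) : laurent :=
  expansion_coef (khovanov_poly D) n.

(** * Knot diagrams as signed oriented Gauss codes *)

(** Travelling once along the knot one passes [c.*2] times through a crossing;
    [passage (a, true)] and [passage (a, false)] are the numbers of the over-
    and of the underpassage of the crossing [a]. *)
Record gauss_diagram : Type := GaussDiagram {
  gcross : nat;
  passage : 'I_gcross * bool -> 'I_(gcross.*2);
  gpositive : 'I_gcross -> bool;
  passage_inj : injective passage
}.

(** The arc number [k] runs from the passage [k] to the next one.  There is a
    single arc, closed, if there is no crossing. *)
Definition out_arc (c : nat) (k : 'I_(c.*2)) : 'I_(c.*2).-1.+1 := inord k.
Definition in_arc (c : nat) (k : 'I_(c.*2)) : 'I_(c.*2).-1.+1 :=
  ord_pred (out_arc k).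

Definition link_of_gauss (G : gauss_diagram) : link_diagram :=
  LinkDiagram (fun a : 'I_(gcross G) =>
    Crossing (in_arc (passage (a, false))) (out_arc (passage (a, false)))
             (in_arc (passage (a, true))) (out_arc (passage (a, true)))
             (gpositive a)).

Definition unknot_diagram : gauss_diagram :=
  @GaussDiagram 0 (fun p : 'I_0 * bool => p.1) (fun=> true)
    (fun p _ _ => match p.1 with Ordinal _ h => False_ind _ (notF h) end).

(** * Oriented knots in the 3-space and their diagrams *)

Section Knots.
Variable R : realType.

Section ClosedPolygon.
Variables (n : nat) (P : 'I_n -> 'rV[R]_3).

(** The parameter [(k, s)] with [0 <= s < 1] designates a point of the edge from
    the [k]-th vertex to the next one, cyclically. *)
Definition param : Type := ('I_n * R)%type.
Definition param_ok (q : param) : bool := 0 <= q.2 < 1.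
Definition param_lt (q r : param) : bool :=
  (q.1 < r.1)%N || (q.1 == r.1) && (q.2 < r.2).

Definition edge_dir (k : 'I_n) : 'rV[R]_3 := P (ordS k) - P k.
Definition point_at (q : param) : 'rV[R]_3 := P q.1 + q.2 *: edge_dir q.1.

Definition simple_closed : Prop :=
  forall q r, param_ok q -> param_ok r -> point_at q = point_at r -> q = r.
End ClosedPolygon.

(** An oriented knot is a simple closed polygon, oriented by the order of its
    vertices. *)
Record knot : Type := Knot {
  nverts : nat;
  vert : 'I_nverts -> 'rV[R]_3;
  nverts_gt0 : (0 < nverts)%N;
  knot_simple : simple_closed vert
}.

Definition planar_proj (u : 'rV[R]_3) : R * R := (u 0 0, u 0 1).
Definition altitude (u : 'rV[R]_3) : R := u 0 2.
Definition planar_det (u w : 'rV[R]_3) : R := u 0 0 * w 0 1 - u 0 1 * w 0 0.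

(** [G] is the diagram of [K] in the [xy]-plane, seen from above: the projection
    of [K] is regular, that is, its only multiple points are transverse double
    points in the interior of edges, and [theta] lists their parameters in the
    order in which they occur along [K], starting from the vertex [0]. *)
Definition is_diagram (K : knot) (G : gauss_diagram) : Prop :=
  exists theta : 'I_(gcross G).*2 -> param (nverts K),
  [/\ forall k, 0 < (theta k).2 < 1,
      forall k l : 'I_(gcross G).*2, (k < l)%N -> param_lt (theta k) (theta l),
      forall q r, param_ok q -> param_ok r -> q <> r ->
        planar_proj (point_at (@vert K) q) = planar_proj (point_at (@vert K) r)
        <-> exists a b, q = theta (passage (a, b)) /\
                        r = theta (passage (a, ~~ b)),
      forall a, altitude (point_at (@vert K) (theta (passage (a, false))))
              < altitude (point_at (@vert K) (theta (passage (a, true))))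
    & forall a : 'I_(gcross G),
        let d := planar_det
          (edge_dir (@vert K) (theta (passage (a, true))).1)
          (edge_dir (@vert K) (theta (passage (a, false))).1) in
        if gpositive a then 0 < d else d < 0].

End Knots.

(** Any knot lying in the [xy]-plane has the crossingless diagram. *)
Lemma unknot_diagramP (R : realType) (K : knot R) :
  (forall k, altitude (@vert R K k) = 0) -> is_diagram K unknot_diagram.
Proof.
move=> flat; exists (fun k : 'I_0 => False_rect _ (notF (ltn_ord k))).
split=> [[]|[]||[]|[]] // q r q_ok r_ok q_neq_r; split=> [pqr|[[]//]].
case: q_neq_r; apply: (knot_simple q_ok r_ok).
have flatp s : altitude (point_at (@vert R K) s) = 0.
  have := flat s.1; have := flat (ordS s.1).
  by rewrite /altitude /point_at /edge_dir !mxE => -> ->; rewrite subrr mulr0 addr0.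
have := flatp q; have := flatp r; move: pqr.
rewrite /planar_proj /altitude => -[px py] zr zq.
apply/rowP => -[[|[|[|//]]] i_lt3].
- by rewrite (_ : Ordinal i_lt3 = 0) //; apply: val_inj.
- by rewrite (_ : Ordinal i_lt3 = 1) //; apply: val_inj.
- by rewrite (_ : Ordinal i_lt3 = 2) ?zr ?zq //; apply: val_inj.
Qed.

(* Main.v *)
From HB Require Import structures.
Require Import Defs.
From mathcomp Require Import all_boot all_order all_algebra reals.
From mathcomp Require Import generic_quotient ring_quotient.
From mathcomp Require Import finmap boolp classical_sets monalg.
From mathcomp Require Import ring lra.

(** The knot is the figure-eight knot.  It is isotopic to its mirror image, so
    its Jones polynomial is invariant under [q -> q^-1] and the odd coefficients
    of its expansion at [q = e^y] vanish, as they do for the unknot.  Its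
    Khovanov homology nevertheless has a summand [Z] in bidegree [(2, 5)], where
    the unknot has none; as [5 ^ 3 / 3! <> 0], this summand contributes a
    monomial [t^2 x^5] to [v_3] that nothing can cancel.

    For the value at [t = -1, x = 1] no homology has to be computed.  Rationally,
    the rank of the homology in bidegree [p] is the number of generators of
    bidegree [p] minus the dimensions of the boundaries in bidegree [p] and in
    the next one ([zrank_ngen]).  When the ranks are summed against a weight
    that changes sign with the homological degree, the boundary terms telescope,
    and the sum can be taken over the generators of the cube ([kh_v_euler]).
    The same formula gives the rank in bidegree [(2, 5)], because the
    neighbouring bidegrees [(1, 5)] and [(3, 5)] carry no generator
    ([zrank_isolated]).

    Both arguments need the differential to square to zero and to have bidegree
    [(1, 0)].  For a given diagram this is a finite verification.  It is made
    on a copy of the cube of smoothings built from lists of booleans and natural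
    numbers, which is shown to agree with the Khovanov complex of any link
    diagram presented by a table of crossings ([code_incidenceE],
    [code_bidegreeE], [sum_code_gens]).

    Finally, a heptagon in space is exhibited whose projection is the alternating
    four-crossing diagram; each pair of its edges is a system of two linear
    equations and four inequalities in the two parameters
    ([fig8_double_point]). *)

Set Implicit Arguments.
Unset Strict Implicit.
Unset Printing Implicit Defensive.

Import Order.TTheory GRing.Theory Num.Theory.
Local Open Scope ring_scope.

(** * Rank of an abelian group *)

Lemma zindep_widen (A : zmodType) (r s : nat) (f : 'I_s -> A) :
  (r <= s)%N -> zindep f -> exists g : 'I_r -> A, zindep g.
Proof.
move=> rs f_ind; exists (fun i => f (widen_ord rs i)) => c c0 i.
pose c' (j : 'I_s) : int := oapp c 0 (insub (val j)).
have c'E j : c' (widen_ord rs j) = c j by rewrite /c' /= valK.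
rewrite -c'E; apply: f_ind; rewrite -[RHS]c0.
under [RHS]eq_bigr => j _ do rewrite -c'E.
rewrite (bigID (fun j : 'I_s => (j < r)%N)) /= [X in _ + X]big1 ?addr0.
  by rewrite (big_ord_narrow rs).
by move=> j jr; rewrite /c' insubN // mulr0z.
Qed.

Lemma has_rank_inj (A : zmodType) (r s : nat) :
  has_rank A r -> has_rank A s -> r = s.
Proof.
move=> [[f fi] nf] [[g gi] ng]; apply/eqP; rewrite eqn_leq.
by apply/andP; split; rewrite leqNgt; apply/negP => lt;
  [apply: ng; apply: zindep_widen lt fi | apply: nf; apply: zindep_widen lt gi].
Qed.

Lemma zrankE (A : zmodType) (r : nat) : has_rank A r -> zrank A = r.
Proof.
move=> rA; apply: has_rank_inj (rA).
by apply: (@xgetPex _ 0%N [set n | has_rank A n]%classic); exists r.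
Qed.

Lemma clear_denominators (I : finType) (c : I -> rat) :
  exists n : int, n != 0 /\ exists c' : I -> int, forall i, c i * n%:~R = (c' i)%:~R.
Proof.
exists (\prod_i denq (c i)); split.
  by apply/prodf_neq0 => i _; apply: denq_neq0.
exists (fun i => numq (c i) * \prod_(j | j != i) denq (c j)) => i.
by rewrite (bigD1 i) //= !intrM mulrA numqE.
Qed.

(** Clearing denominators turns linear independence over the integers in [A]
    into linear independence over the rationals.  The map [psi] presents [A] up
    to torsion as a lattice in the quotient of [U] by [W].  As [A] will be a
    quotient of subgroups, the hypotheses bear on a group [Z] mapping onto it,
    so that no map out of [A] has to be defined. *)
Lemma has_rank_span (Z A : zmodType) (V : vectType rat) (pi : {additive Z -> A})
    (psi : {additive Z -> V}) (U W : {vspace V}) :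
    (forall a, exists z, pi z = a) ->
    (forall z, psi z \in U) ->
    (forall u, u \in U -> exists n : int, n != 0 /\ exists z, psi z = u *~ n) ->
    (W <= U)%VS ->
    (forall z, pi z = 0 -> psi z \in W) ->
    (forall z, psi z \in W -> exists n : int, n != 0 /\ pi z *~ n = 0) ->
  has_rank A (\dim U - \dim W).
Proof.
move=> pi_surj psiU psi_onto WU piW Wpi.
(* The image of [U] under [g], which kills exactly [W], replaces [U / W]. *)
pose g := (\1 - projv W)%VF : 'End(V).
have gE v : g v = v - projv W v by rewrite add_lfunE opp_lfunE id_lfunE.
have kerg : lker g = W.
  apply/vspaceP => v; rewrite memv_ker gE subr_eq0.
  by apply/eqP/idP => [-> | /projv_id ->]; rewrite ?memv_proj.
have -> : (\dim U - \dim W)%N = \dim (g @: U).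
  by rewrite -(limg_ker_dim g U) kerg (capv_idPr WU) addKn.
have intZ (n : int) (v : V) : v *~ n = n%:~R *: v by rewrite scaler_int.
(* Lower bound: multiples of a basis of [g @: U] lift to an independent family. *)
set r := \dim (g @: U); split.
  have basis_lift (i : 'I_r) : exists az : int * Z, az.1 != 0 /\
      g (psi az.2) = (vbasis (g @: U))`_i *~ az.1.
    have /memv_imgP[u uU ->] : (vbasis (g @: U))`_i \in (g @: U)%VS.
      by apply: vbasis_mem; rewrite mem_nth // size_tuple.
    have [n [n0 [z zE]]] := psi_onto u uU.
    by exists (n, z); split=> //=; rewrite zE raddfMz.
  have [az azP] := boolp.choice basis_lift.
  exists (fun i => pi (az i).2) => c c0 i.
  have : \sum_i (c i * (az i).1)%:~R *: (vbasis (g @: U))`_i = 0.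
    have /piW : pi (\sum_i (az i).2 *~ c i) = 0.
      by rewrite raddf_sum -[RHS]c0; apply: eq_bigr => j _; rewrite raddfMz.
    rewrite -kerg memv_ker => /eqP; rewrite !raddf_sum; apply: etrans.
    apply: eq_bigr => j _; rewrite !raddfMz /= (proj2 (azP j)).
    by rewrite -intZ mulrC mulrzA.
  have /freeP/[apply]/(_ i)/eqP := basis_free (vbasisP (g @: U)).
  by rewrite intr_eq0 mulf_eq0 (negPf (proj1 (azP i))) orbF => /eqP.
(* Upper bound: [r + 1] elements have dependent images in [g @: U], and a
   relation between the images is, up to torsion, a relation in [A]. *)
case=> f f_ind.
have lift_f i : exists z, pi z = f i by apply: pi_surj.
have [z zE] := boolp.choice lift_f.
pose X := [tuple g (psi (z i)) | i < r.+1].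
have notfree : ~~ free X.
  apply/negP; rewrite /free size_tuple => /eqP dimX.
  have : (<<X>> <= g @: U)%VS.
    apply/span_subvP => _ /mapP[i _ ->]; exact: memv_img.
  by move/dimvS; rewrite dimX ltnn.
have [k k0 [i ki0]] : exists2 k, \sum_(i < r.+1) k i *: X`_i = 0 & exists i, k i != 0.
  apply: contrapT => H; move/negP: notfree; apply; apply/freeP => k k0 i.
  by apply: contrapT => /eqP ki; apply: H; exists k => //; exists i.
have [n [n0 [k' k'E]]] := clear_denominators k.
have XE (j : 'I_r.+1) : X`_j = g (psi (z j)) by rewrite -tnth_nth tnth_mktuple.
have : psi (\sum_i z i *~ k' i) \in W.
  rewrite -kerg memv_ker !raddf_sum; apply/eqP.
  transitivity (n%:~R *: \sum_(i < r.+1) k i *: X`_i); last by rewrite k0 scaler0.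
  rewrite scaler_sumr; apply: eq_bigr => j _.
  by rewrite !raddfMz XE scalerA mulrC k'E intZ.
move=> /Wpi[m [m0]]; rewrite raddf_sum mulrz_suml => sum0.
have : forall i, k' i * m = 0.
  apply: f_ind; rewrite -[RHS]sum0; apply: eq_bigr => j _.
  by rewrite raddfMz zE mulrzA.
move/(_ i)/eqP; rewrite mulf_eq0 (negPf m0) orbF => /eqP k'i.
by move/eqP: (k'E i); rewrite k'i mulf_eq0 (negPf ki0) intr_eq0 (negPf n0).
Qed.

(** * The Khovanov complex over the rationals *)

Section RationalComplex.
Variable D : link_diagram.
Local Notation chain := {ffun gen D -> int}.
Local Notation chainQ := {ffun gen D -> rat^o}.

Definition to_rat (f : chain) : chainQ := [ffun x => (f x)%:~R].

Lemma to_ratB : {morph to_rat : f g / f - g}.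
Proof. by move=> f g; apply/ffunP => x; rewrite !ffunE intrB. Qed.

HB.instance Definition _ :=
  GRing.isZmodMorphism.Build chain chainQ to_rat to_ratB.

Lemma to_rat_inj : injective to_rat.
Proof.
move=> f g /ffunP fg; apply/ffunP => x.
by have := fg x; rewrite !ffunE => /intr_inj.
Qed.

Definition rat_diff_fun (f : chainQ) : chainQ :=
  [ffun y => \sum_x f x * (incidence x y)%:~R].

Lemma rat_diff_linear : linear rat_diff_fun.
Proof.
move=> a f g; apply/ffunP => y; rewrite !ffunE scaler_sumr -big_split /=.
by apply: eq_bigr => x _; rewrite !ffunE mulrDl scalerAl.
Qed.
HB.instance Definition _ :=
  GRing.isLinear.Build rat chainQ chainQ _ rat_diff_fun rat_diff_linear.

Definition rat_diff : 'End(chainQ) := linfun rat_diff_fun.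

Lemma rat_diffE f y : rat_diff f y = \sum_x f x * (incidence x y)%:~R.
Proof. by rewrite lfunE /= ffunE. Qed.

Lemma to_rat_diff f : to_rat (kh_diff f) = rat_diff (to_rat f).
Proof.
apply/ffunP => y; rewrite rat_diffE !ffunE rmorph_sum /=.
by apply: eq_bigr => x _; rewrite !ffunE intrM.
Qed.

Lemma rat_chain_multiple (u : chainQ) :
  exists n : int, n != 0 /\ exists f : chain, to_rat f = u *~ n.
Proof.
have [n [n0 [c cE]]] := clear_denominators (u : gen D -> rat).
exists n; split=> //; exists [ffun x => c x]; apply/ffunP => x.
rewrite !ffunE -cE -[u *~ n]scaler_int ffunE; exact: mulrC.
Qed.

Definition delta (x : gen D) : chainQ := [ffun y => (x == y)%:R].

Lemma rat_chainE (f : chainQ) : f = \sum_x f x *: delta x.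
Proof.
apply/ffunP => y; rewrite sum_ffunE (bigD1 y) //= big1 => [|x /negPf xy].
  by rewrite !ffunE eqxx addr0 [RHS]mulr1.
by rewrite !ffunE xy scaler0.
Qed.

Lemma span_delta (s : seq (gen D)) (f : chainQ) :
  (f \in <<[seq delta x | x <- s]>>%VS) = [forall x, (f x != 0) ==> (x \in s)].
Proof.
apply/idP/forallP => [fs x | fs].
  apply/implyP; apply: contraR => xs.
  pose ev (g : chainQ) : rat^o := g x.
  have ev_lin : linear ev by move=> a g h; rewrite /ev !ffunE.
  pose evL : {linear chainQ -> rat^o} :=
    HB.pack ev (GRing.isLinear.Build rat chainQ (rat^o) _ ev ev_lin).
  have : (<<[seq delta x | x <- s]>> <= lker (linfun evL))%VS.
    apply/span_subvP => _ /mapP[y ys ->]; rewrite memv_ker lfunE /= /ev ffunE.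
    by have [yx | _] := eqVneq y x; [rewrite -yx ys in xs | rewrite eqxx].
  by move/subvP/(_ f fs); rewrite memv_ker lfunE.
rewrite [f]rat_chainE; apply: memv_suml => x _.
have [-> | /(implyP (fs x)) xs] := eqVneq (f x) 0; first by rewrite scale0r mem0v.
by apply/memvZ/memv_span/map_f.
Qed.

Lemma free_delta (s : seq (gen D)) : uniq s -> free [seq delta x | x <- s].
Proof.
elim: s => [|x s IHs] /=; first by rewrite nil_free.
case/andP=> xs /IHs s_free; rewrite free_cons s_free andbT span_delta.
by apply/forallPn; exists x; rewrite ffunE eqxx oner_eq0 (negPf xs).
Qed.

Definition bideg_space (p : int * int) : {vspace chainQ} :=
  <<[seq delta x | x <- enum [pred x | bidegree x == p]]>>%VS.

Lemma dim_bideg_space p :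
  \dim (bideg_space p) = #|[pred x : gen D | bidegree x == p]|.
Proof.
by have /eqP := free_delta (enum_uniq [pred x : gen D | bidegree x == p]);
  rewrite size_map -cardE.
Qed.

Lemma mem_bideg_space p f :
  (f \in bideg_space p) = [forall x, (f x != 0) ==> (bidegree x == p)].
Proof. by rewrite span_delta; apply: eq_forallb => x; rewrite mem_enum. Qed.

Lemma mem_to_rat p f : (to_rat f \in bideg_space p) = homogeneous p f.
Proof.
by rewrite mem_bideg_space; apply: eq_forallb => x; rewrite ffunE intr_eq0.
Qed.

Definition prev_bideg (p : int * int) : int * int := (p.1 - 1, p.2).
Definition next_bideg (p : int * int) : int * int := (p.1 + 1, p.2).

Lemma prev_bidegK : cancel prev_bideg next_bideg.
Proof. by case=> i j; rewrite /next_bideg subrK. Qed.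

Lemma next_bidegK : cancel next_bideg prev_bideg.
Proof. by case=> i j; rewrite /prev_bideg addrK. Qed.

Definition cycle_space p := (bideg_space p :&: lker rat_diff)%VS.
Definition boundary_space p := (rat_diff @: bideg_space (prev_bideg p))%VS.

Hypothesis diff_bideg : forall x y : gen D,
  incidence x y != 0 -> bidegree y = next_bideg (bidegree x).
Hypothesis diff_diff : forall x z : gen D,
  \sum_y incidence x y * incidence y z = 0.

Lemma rat_diff_diff f : rat_diff (rat_diff f) = 0.
Proof.
apply/ffunP => z; rewrite rat_diffE ffunE.
under eq_bigr => y _ do rewrite rat_diffE mulr_suml.
rewrite exchange_big big1 //= => x _.
under eq_bigr => y _ do rewrite -mulrA -intrM.
by rewrite -mulr_sumr -rmorph_sum /= diff_diff mulr0.
Qed.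

Lemma boundary_sub_bideg p : (boundary_space p <= bideg_space p)%VS.
Proof.
apply/subvP => _ /memv_imgP[f fp ->]; rewrite mem_bideg_space.
apply/forallP => y; apply/implyP; rewrite rat_diffE; apply: contraNT => yp.
rewrite big1 // => x _; have [-> | i0] := eqVneq (incidence x y) 0.
  by rewrite mulr0.
have [-> | fx0] := eqVneq (f x) 0; first by rewrite mul0r.
move: fp; rewrite mem_bideg_space => /forallP/(_ x); rewrite fx0 /= => /eqP xp.
by case/negP: yp; rewrite (diff_bideg i0) xp prev_bidegK.
Qed.

Lemma boundary_sub_cycle p : (boundary_space p <= cycle_space p)%VS.
Proof.
rewrite subv_cap boundary_sub_bideg /=.
by apply/subvP => _ /memv_imgP[f fp ->]; rewrite memv_ker rat_diff_diff.
Qed.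

Lemma dim_cycle_space p :
  (\dim (cycle_space p) + \dim (boundary_space (next_bideg p)))%N
    = #|[pred x : gen D | bidegree x == p]|.
Proof. by rewrite -dim_bideg_space /boundary_space next_bidegK limg_ker_dim. Qed.

(** The boundaries of the integral complex span the rational ones up to
    multiples, which is all that [has_rank_span] asks for. *)
Lemma zrank_homology p :
  zrank (khovanov_homology D p)
    = (\dim (cycle_space p) - \dim (boundary_space p))%N.
Proof.
pose psi (z : Defs.cycle D p) := to_rat (val z).
have psiB : {morph psi : y z / y - z} by move=> y z; rewrite /psi !raddfB.
pose psiA : {additive Defs.cycle D p -> chainQ} :=
  HB.pack psi (GRing.isZmodMorphism.Build _ _ psi psiB).
pose pi : {additive Defs.cycle D p -> khovanov_homology D p} :=
  \pi_(Quotient.quot (@is_boundary D p))%qT.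
have pi0 z : (pi z == 0) = (z \in @is_boundary D p).
  by rewrite -[0](raddf0 pi) -[z in RHS]subr0 Quotient.idealrBE.
apply: zrankE; apply: (has_rank_span (pi := pi) (psi := psiA)).
- by move=> a; exists (repr a); apply: reprK.
- move=> z; rewrite memv_cap mem_to_rat memv_ker -to_rat_diff.
  by case/andP: (valP z) => -> /eqP ->; rewrite raddf0 eqxx.
- move=> u; rewrite memv_cap memv_ker => /andP[up /eqP du].
  have [n [n0 [f fE]]] := rat_chain_multiple u.
  have f_cycle : f \in @is_cycle D p.
    rewrite inE -mem_to_rat fE -scaler_int memvZ //=; apply/eqP/to_rat_inj.
    by rewrite to_rat_diff fE raddfMz /= du mul0rz raddf0.
  by exists n; split=> //; exists (Cycle f_cycle).
- exact: boundary_sub_cycle.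
- move=> z /eqP; rewrite pi0 => /asboolP[g gp gz] /=.
  by rewrite /psi -gz to_rat_diff memv_img // mem_to_rat.
move=> z /memv_imgP[u up zE].
have [n [n0 [g gE]]] := rat_chain_multiple u.
exists n; split=> //; apply/eqP; rewrite -raddfMz pi0; apply/asboolP.
exists g; first by rewrite -mem_to_rat gE -scaler_int memvZ.
by apply: to_rat_inj; rewrite to_rat_diff gE !raddfMz /= -zE.
Qed.

End RationalComplex.

(** * Euler characteristic of the Khovanov complex *)

Lemma eq_big_support (T : eqType) (V : nmodType) (r s : seq T) (F : T -> V) :
    uniq r -> uniq s -> (forall p, F p != 0 -> (p \in r) = (p \in s)) ->
  \sum_(p <- r) F p = \sum_(p <- s) F p.
Proof.
move=> ur us rs; have supp (t : seq T) :
    \sum_(p <- t) F p = \sum_(p <- [seq p <- t | F p != 0]) F p.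
  rewrite big_filter [RHS]big_mkcond; apply: eq_bigr => p _.
  by case: eqP.
rewrite supp [RHS]supp; apply: perm_big; apply: uniq_perm; rewrite ?filter_uniq //.
by move=> p; rewrite !mem_filter; case: eqVneq => //= /rs.
Qed.

Lemma laurent_eval_seq (P : laurent) (s : seq (int * int)) (t x : rat) :
    uniq s -> (forall p, P@_p != 0 -> p \in s) ->
  laurent_eval P t x = \sum_(p <- s) P@_p * t ^ p.1 * x ^ p.2.
Proof.
move=> us Ps; apply: eq_big_support => // p.
rewrite -mcoeff_neq0 -mulrA mulf_eq0 negb_or => /andP[Pp _].
by rewrite Pp (Ps p Pp).
Qed.

Lemma mcoeff_sumU (s : seq (int * int)) (F : int * int -> rat) p : uniq s ->
  (\sum_(q <- s) << F q *g q >> : laurent)@_p = if p \in s then F p else 0.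
Proof.
move=> us; rewrite raddf_sum /=; case: ifPn => ps.
  rewrite (big_rem p) //= mcoeffUU big_seq big1 ?addr0 // => q.
  rewrite mem_rem_uniq // inE => /andP[/negPf qp _].
  by rewrite mcoeffU qp.
rewrite big_seq big1 // => q qs.
by rewrite mcoeffU; case: eqP qs ps => // -> ->.
Qed.

Lemma mcoeff_expansion (P : laurent) n p :
  (expansion_coef P n)@_p = P@_p * exp_coef p.2 n.
Proof.
rewrite /expansion_coef mcoeff_sumU ?fset_uniq //; case: ifPn => // pP.
by rewrite (mcoeff_outdom pP) mul0r.
Qed.

Section EulerCharacteristic.
Variable D : link_diagram.
Hypothesis diff_bideg : forall x y : gen D,
  incidence x y != 0 -> bidegree y = next_bideg (bidegree x).
Hypothesis diff_diff : forall x z : gen D,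
  \sum_y incidence x y * incidence y z = 0.

Local Notation ngen p := #|[pred x : gen D | bidegree x == p]|.
Local Notation b p := (\dim (@boundary_space D p)).
Local Notation bidegs := (undup [seq bidegree x | x : gen D]).

Lemma mem_bidegs p : (p \in bidegs) = (0 < ngen p)%N.
Proof.
rewrite mem_undup; apply/mapP/card_gt0P => [[x _ ->] | [x /eqP <-]].
  by exists x; rewrite inE.
by exists x; rewrite ?mem_enum.
Qed.

Lemma dim_boundary_le p : (b p <= ngen p)%N.
Proof. by rewrite -dim_bideg_space; apply/dimvS/boundary_sub_bideg. Qed.

Lemma dim_boundary_le_prev p : (b p <= ngen (prev_bideg p))%N.
Proof. by rewrite -(dim_cycle_space D) prev_bidegK leq_addl. Qed.

(** Rank-nullity for the outgoing differential eliminates the dimension of the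
    cycles. *)
Lemma zrank_ngen p :
  (zrank (khovanov_homology D p) + b p + b (next_bideg p))%N = ngen p.
Proof.
rewrite zrank_homology // subnK; last exact/dimvS/boundary_sub_cycle.
exact: dim_cycle_space.
Qed.

Lemma mcoeff_khovanov_poly p :
  (khovanov_poly D)@_p = (zrank (khovanov_homology D p))%:R.
Proof.
rewrite /khovanov_poly mcoeff_sumU ?undup_uniq //; case: ifPn => //.
rewrite mem_bidegs -eqn0Ngt => /eqP n0.
by move: (zrank_ngen p); rewrite n0; case: (zrank _).
Qed.

Lemma mcoeff_kh_v n p :
  (kh_v n D)@_p = (zrank (khovanov_homology D p))%:R * exp_coef p.2 n.
Proof. by rewrite mcoeff_expansion mcoeff_khovanov_poly. Qed.

(** Up to sign, the dimension of the boundaries of bidegree [p] occurs once in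
    the rank at [p] and once in the rank at [prev_bideg p]; the two weights are
    opposite. *)
Lemma kh_v_euler n :
  laurent_eval (kh_v n D) (-1) 1
    = \sum_(x : gen D) exp_coef (bidegree x).2 n * (-1) ^ (bidegree x).1.
Proof.
pose w (p : int * int) : rat := exp_coef p.2 n * (-1) ^ p.1.
have w_next p : w (next_bideg p) = - w p.
  by rewrite /w /= expfzDr ?expr1z ?mulrN1 ?mulrN ?oppr_eq0 ?oner_eq0.
rewrite (@laurent_eval_seq _ bidegs) ?undup_uniq //; last first.
  move=> p; apply: contraNT; rewrite mem_bidegs -eqn0Ngt => /eqP n0.
  by rewrite mcoeff_kh_v; move: (zrank_ngen p); rewrite n0; case: (zrank _);
    rewrite // mul0r.
transitivity (\sum_(p <- bidegs) (ngen p)%:R * w p).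
  have next_inj := can_inj next_bidegK.
  (* Shifting the range of summation by one homological degree does not matter:
     boundaries of bidegree [p] require generators in [p] and in [prev_bideg p]. *)
  have shift : \sum_(p <- bidegs) (b (next_bideg p))%:R * w p
      = - \sum_(p <- bidegs) (b p)%:R * w p.
    rewrite [in RHS](@eq_big_support _ _ _ [seq next_bideg p | p <- bidegs]).
    - rewrite big_map -sumrN; apply: eq_bigr => p _.
      by rewrite w_next mulrN opprK.
    - exact: undup_uniq.
    - by rewrite map_inj_uniq // undup_uniq.
    move=> p; rewrite mulf_eq0 negb_or pnatr_eq0 -lt0n => /andP[bp _].
    rewrite mem_bidegs (leq_trans bp (dim_boundary_le p)) -[p in RHS]prev_bidegK.
    by rewrite mem_map // mem_bidegs (leq_trans bp (dim_boundary_le_prev p)).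
  apply: etrans (_ : \sum_(p <- bidegs) ((ngen p)%:R * w p
      - (b p)%:R * w p - (b (next_bideg p))%:R * w p) = _); last first.
    by rewrite !sumrB shift opprK subrK.
  apply: eq_bigr => p _; rewrite mcoeff_kh_v exp1rz mulr1 -zrank_ngen !natrD /w.
  ring.
under eq_bigr => p _ do rewrite mulr_natl -sumr_const.
rewrite (exchange_big_dep xpredT) //=; apply: eq_bigr => x _.
have xS : bidegree x \in bidegs.
  by rewrite mem_bidegs; apply/card_gt0P; exists x; rewrite inE.
rewrite big_mkcond (big_rem _ xS) /= inE eqxx big_seq big1 ?addr0 // => p.
by rewrite mem_rem_uniq ?undup_uniq // !inE eq_sym => /andP[/negPf->].
Qed.

(** No differential enters or leaves, so homology is the chain group itself. *)
Lemma zrank_isolated p :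
  ngen (prev_bideg p) = 0%N -> ngen (next_bideg p) = 0%N ->
  zrank (khovanov_homology D p) = ngen p.
Proof.
move=> prev0 next0; rewrite -zrank_ngen.
have := dim_boundary_le_prev p; have := dim_boundary_le (next_bideg p).
by rewrite prev0 next0 !leqn0 => /eqP-> /eqP->; rewrite !addn0.
Qed.

End EulerCharacteristic.

(** * A computable copy of the cube of smoothings *)

Fixpoint bits (n : nat) : seq bitseq :=
  if n is k.+1 then [seq b :: s | b <- [:: true; false], s <- bits k]
  else [:: [::]].

Lemma mem_bits n s : (s \in bits n) = (size s == n).
Proof.
elim: n s => [|n IHn] s; first by rewrite inE size_eq0.
apply/allpairsP/idP => [[[b t] /= [_ + ->]] | ]; first by rewrite IHn.
by case: s => // b t /= st; exists (b, t); rewrite IHn -eqSS st; case: b.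
Qed.

(** A sum which reduces: the general iterated operators are opaque to evaluation. *)
Definition sumz : seq int -> int := foldr +%R 0.

Lemma sumzE (I : Type) (r : seq I) (P : pred I) (F : I -> int) :
  sumz [seq F i | i <- r & P i] = \sum_(i <- r | P i) F i.
Proof. by rewrite /sumz foldrE big_map big_filter. Qed.

Lemma card_ord_count n (P : pred nat) :
  #|[set i : 'I_n | P i]| = count P (iota 0 n).
Proof. by rewrite cardsE cardE -val_enum_ord count_map -size_filter enumT. Qed.

Lemma all_ord n (P : pred nat) : [forall i : 'I_n, P i] = all P (iota 0 n).
Proof.
rewrite -val_enum_ord all_map; apply/forallP/allP => H i //=.
by apply: H; rewrite mem_enum.
Qed.

Lemma sumz_ord n (P : pred nat) (F : nat -> int) :
  \sum_(i < n | P i) F i = sumz [seq F i | i <- iota 0 n & P i].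
Proof. by rewrite sumzE -val_enum_ord big_map big_enum_cond. Qed.

Definition crossing_code : Type := (nat * nat * nat * nat * bool)%type.
Definition code_of_crossing m (c : crossing m) : crossing_code :=
  (val (uin c), val (uout c), val (oin c), val (oout c), positive c).

Definition code_smoothing (b : bool) (c : crossing_code) : seq (nat * nat) :=
  let: (ui, uo, oi, oo, p) := c in
  if b (+) p then [:: (ui, oo); (oi, uo)] else [:: (ui, oi); (uo, oo)].

Section Model.
Variables (n m : nat) (table : seq crossing_code).

Definition code_cross (a : nat) := nth (0, 0, 0, 0, false)%N table a.
Definition code_uin a := (code_cross a).1.1.1.1.
Definition code_uout a := (code_cross a).1.1.1.2.
Definition code_pos a := (code_cross a).2.

Definition code_pairs (s : bitseq) : seq (nat * nat) :=
  flatten [seq code_smoothing (nth false s a) (code_cross a) | a <- iota 0 n].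

Definition code_step (s : bitseq) (C : seq nat) : seq nat :=
  undup (C ++ [seq p.2 | p <- code_pairs s & p.1 \in C]
           ++ [seq p.1 | p <- code_pairs s & p.2 \in C]).

(** The arcs reached from [e]; [m] rounds suffice as each one adds an arc until
    the set is closed, which [code_circle_closed] certifies. *)
Definition code_circle (s : bitseq) (e : nat) : seq nat :=
  iter m (code_step s) [:: e].

Definition code_circle_closed (s : bitseq) : bool :=
  all (fun e => let C := code_circle s e in
    all (fun p => (p.1 \in C) == (p.2 \in C)) (code_pairs s)) (iota 0 m).

Definition code_circles (s : bitseq) : seq (seq nat) :=
  [seq code_circle s e | e <- iota 0 m].

Definition code_compatible (C : seq (seq nat)) (t : bitseq) : bool :=
  all (fun e => all (fun f => (f \in nth [::] C e) ==>
    (nth false t e == nth false t f)) (iota 0 m)) (iota 0 m).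

(** A generator is coded by the states of the crossings, the labels of the arcs
    and the circle of each arc, which is determined by the states but stored in
    order to be computed only once per vertex. *)
Definition gen_code : Type := (bitseq * bitseq * seq (seq nat))%type.

Definition code_gens : seq gen_code :=
  flatten [seq let C := code_circles s in
    [seq (s, t, C) | t <- bits m & code_compatible C t] | s <- bits n].

Definition code_same (c : gen_code) (e f : nat) : bool := f \in nth [::] c.2 e.
Definition code_state (c : gen_code) (a : nat) : bool := nth false c.1.1 a.
Definition code_label (c : gen_code) (e : nat) : bool := nth false c.1.2 e.

Definition code_height (c : gen_code) : nat := count (code_state c) (iota 0 n).
Definition code_npos : nat := count code_pos (iota 0 n).
Definition code_nneg : nat := count (fun a => ~~ code_pos a) (iota 0 n).

(** A circle is counted at its least arc. *)
Definition code_label_degree (c : gen_code) : int :=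
  sumz [seq (if code_label c e then 1 else -1) | e <- iota 0 m
    & all (leq e) (nth [::] c.2 e)].

Definition code_bidegree (c : gen_code) : int * int :=
  ((code_height c)%:Z - code_nneg%:Z,
   code_label_degree c + (code_height c)%:Z + code_npos%:Z - (code_nneg.*2)%:Z).

Definition code_edge (a : nat) (c d : gen_code) : bool :=
  [&& ~~ code_state c a, code_state d a
    & all (fun b => (b != a) ==> (code_state c b == code_state d b)) (iota 0 n)].

Definition code_unchanged (a : nat) (c d : gen_code) : bool :=
  all (fun e => [|| code_same c e (code_uin a), code_same c e (code_uout a)
                  | code_label c e == code_label d e]) (iota 0 m).

Definition code_local (a : nat) (c d : gen_code) : bool :=
  let ui := code_uin a in let uo := code_uout a in
  if ~~ code_same c ui uo then
    mult_coef (code_label c ui) (code_label c uo) (code_label d ui)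
  else if ~~ code_same d ui uo then
    comult_coef (code_label c ui) (code_label d ui) (code_label d uo)
  else false.

Definition code_sign (a : nat) (c : gen_code) : int :=
  if odd (count (fun b => (b < a)%N && code_state c b) (iota 0 n)) then -1 else 1.

(** [if] rather than a conjunction: call-by-value evaluation would otherwise test
    the second condition for every pair of generators. *)
Definition code_incidence (c d : gen_code) : int :=
  sumz [seq code_sign a c * (code_local a c d)%:R | a <- iota 0 n
    & if code_edge a c d then code_unchanged a c d else false].

End Model.

Section ModelCorrect.
Variables (D : link_diagram) (table : seq crossing_code).
Local Notation n := (ncross D).
Local Notation m := (narcs D).
Hypothesis tableE :
  forall a : 'I_n, code_of_crossing (cross a) = code_cross table a.
Hypothesis circle_closed : all (code_circle_closed n m table) (bits n).

Local Notation circle := (code_circle n m table).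

Definition code_fun k (f : {ffun 'I_k -> bool}) : bitseq := val (fgraph f).

Lemma nth_code_fun k (f : {ffun 'I_k -> bool}) (i : 'I_k) :
  nth false (code_fun f) i = f i.
Proof. exact: nth_fgraph_ord. Qed.

Lemma size_code_fun k (f : {ffun 'I_k -> bool}) : size (code_fun f) = k.
Proof. by rewrite size_tuple card_ord. Qed.

Lemma code_fun_inj k : injective (@code_fun k).
Proof. by move=> f g fg; apply/ffunP => i; rewrite -!nth_code_fun fg. Qed.

Lemma code_fun_mem k (f : {ffun 'I_k -> bool}) : code_fun f \in bits k.
Proof. by rewrite mem_bits size_code_fun. Qed.

Lemma code_fun_surj k s : s \in bits k -> exists f, @code_fun k f = s.
Proof.
rewrite mem_bits => /eqP sk; exists [ffun i : 'I_k => nth false s i].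
apply: (@eq_from_nth _ false) => [|i]; rewrite size_code_fun ?sk // => ik.
by rewrite (nth_code_fun _ (Ordinal ik)) ffunE.
Qed.

Lemma mem_code_pairs (v : {ffun 'I_n -> bool}) (p : nat * nat) :
  p \in code_pairs n table (code_fun v) <->
  exists e f : 'I_m, p = (val e, val f) /\
    exists a, (e, f) \in smoothing (v a) (cross a).
Proof.
have smE (a : 'I_n) : code_smoothing (v a) (code_cross table a)
    = [seq (val q.1, val q.2) | q <- smoothing (v a) (cross a)].
  by rewrite -tableE /smoothing /=; case: (_ (+) _).
split=> [/flatten_mapP[k] | [e [f [-> [a efa]]]]].
  rewrite mem_iota => kn; rewrite (nth_code_fun v (Ordinal kn)).
  rewrite (smE (Ordinal kn)) => /mapP[[e f] efa ->].
  by exists e, f; split=> //; exists (Ordinal kn).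
apply/flatten_mapP; exists (val a); first by rewrite mem_iota /=.
by rewrite nth_code_fun smE; apply/mapP; exists (e, f).
Qed.

Lemma joined_pairs (v : {ffun 'I_n -> bool}) (e f : 'I_m) : joined v e f <->
  (val e, val f) \in code_pairs n table (code_fun v) \/
  (val f, val e) \in code_pairs n table (code_fun v).
Proof.
split=> [/existsP[a /orP[] efa] | ].
- by left; apply/mem_code_pairs; exists e, f; split=> //; exists a.
- by right; apply/mem_code_pairs; exists f, e; split=> //; exists a.
by case=> /mem_code_pairs[e' [f' [[/val_inj-> /val_inj->] [a efa]]]];
  apply/existsP; exists a; rewrite efa ?orbT.
Qed.

Lemma joined_sym (v : {ffun 'I_n -> bool}) : symmetric (joined v).
Proof. by move=> e f; apply: eq_existsb => a; rewrite orbC. Qed.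

Lemma same_circle_sym (v : {ffun 'I_n -> bool}) : connect_sym (joined v).
Proof. by apply: sym_connect_sym; apply: joined_sym. Qed.

Lemma mem_code_circle (v : {ffun 'I_n -> bool}) (e : 'I_m) j :
  j \in circle (code_fun v) (val e) ->
  exists2 g : 'I_m, val g = j & same_circle v e g.
Proof.
rewrite /code_circle; move: (m in iter m _ _) => k; elim: k j => [|k IHk] j.
  by rewrite inE => /eqP->; exists e => //; apply: connect0.
rewrite iterS mem_undup !mem_cat => /or3P[/IHk // | |] /mapP[p];
  rewrite mem_filter => /andP[/IHk[g gp eg] pp] ->;
  have [g1 [g2 [pE _]]] := (proj1 (mem_code_pairs _ _) pp).
- exists g2; first by rewrite pE.
  apply: connect_trans eg (connect1 _); apply/joined_pairs.
  by left; rewrite gp; move: pp; rewrite pE.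
exists g1; first by rewrite pE.
apply: connect_trans eg (connect1 _); apply/joined_pairs.
by right; rewrite gp; move: pp; rewrite pE.
Qed.

(** A set of arcs that is closed under joining and contains [e] contains the
    circle of [e]; conversely every arc reached is joined to [e] by a path. *)
Lemma same_circleE (v : {ffun 'I_n -> bool}) (e f : 'I_m) :
  same_circle v e f = (val f \in circle (code_fun v) (val e)).
Proof.
have in_circle k : val e \in iter k (code_step n table (code_fun v)) [:: val e].
  elim: k => [|k IHk]; first by rewrite inE.
  by rewrite iterS mem_undup mem_cat IHk.
apply/idP/idP => [ef | ].
  have /allP/(_ _ (code_fun_mem v))/allP := circle_closed.
  move=> /(_ (val e)); rewrite mem_iota /= => /(_ (ltn_ord e))/allP cl.
  have : closed (joined v) [pred g : 'I_m | val g \in circle (code_fun v) (val e)].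
    by move=> g h /joined_pairs[/cl | /cl] /eqP; rewrite !inE.
  move/closed_connect/(_ e f ef); rewrite !inE => <-.
  exact: in_circle.
by move/mem_code_circle => [g /val_inj->].
Qed.

Definition code_of_gen (x : gen D) : gen_code :=
  (code_fun (val x).1, code_fun (val x).2,
   code_circles n m table (code_fun (val x).1)).

Lemma nth_code_circles (v : {ffun 'I_n -> bool}) (e : 'I_m) :
  nth [::] (code_circles n m table (code_fun v)) e = circle (code_fun v) e.
Proof. by rewrite (nth_map 0%N) ?size_iota // nth_iota. Qed.

Lemma code_sameE (x : gen D) (e f : 'I_m) :
  same_circle (val x).1 e f = code_same (code_of_gen x) e f.
Proof. by rewrite same_circleE /code_same nth_code_circles. Qed.

Lemma code_labelE (x : gen D) (e : 'I_m) : (val x).2 e = code_label (code_of_gen x) e.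
Proof. by rewrite /code_label nth_code_fun. Qed.

Lemma code_stateE (x : gen D) (a : 'I_n) : (val x).1 a = code_state (code_of_gen x) a.
Proof. by rewrite /code_state nth_code_fun. Qed.

Lemma code_of_gen_inj : injective code_of_gen.
Proof.
move=> x y [/code_fun_inj v /code_fun_inj t _].
by apply: val_inj; apply: injective_projections.
Qed.

Lemma code_compatibleE (v : {ffun 'I_n -> bool}) (t : {ffun 'I_m -> bool}) :
  is_gen (v, t) =
  code_compatible m (code_circles n m table (code_fun v)) (code_fun t).
Proof.
rewrite /code_compatible -all_ord; apply: eq_forallb => e /=.
rewrite -all_ord; apply: eq_forallb => f /=.
by rewrite same_circleE nth_code_circles !nth_code_fun.
Qed.

Lemma code_gensP c :
  (c \in code_gens n m table) <-> exists x, c = code_of_gen x.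
Proof.
split=> [/flatten_mapP[s sn /mapP[t]] | [[[v t] x_gen] ->]].
  rewrite mem_filter => /andP[].
  move=> + tm; have [f <-] := code_fun_surj tm; have [v <-] := code_fun_surj sn.
  by rewrite -code_compatibleE => x_gen ->; exists (Sub (v, f) x_gen).
apply/flatten_mapP; exists (code_fun v); first exact: code_fun_mem.
apply/mapP; exists (code_fun t); last by [].
by rewrite mem_filter code_fun_mem andbT -code_compatibleE.
Qed.

Lemma sum_code_gens (V : nmodType) (F : gen_code -> V) :
    uniq (code_gens n m table) ->
  \sum_(x : gen D) F (code_of_gen x) = \sum_(c <- code_gens n m table) F c.
Proof.
move=> gens_uniq; rewrite -big_enum -(big_map code_of_gen xpredT F).
apply: perm_big; apply: uniq_perm => //.
  by rewrite map_inj_uniq ?enum_uniq //; apply: code_of_gen_inj.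
move=> c; apply/mapP/idP => [[x _ ->] | /code_gensP[x ->]].
  by apply/code_gensP; exists x.
by exists x; rewrite ?mem_enum.
Qed.

Lemma code_crossE (a : 'I_n) :
  [/\ val (uin (cross a)) = code_uin table a,
      val (uout (cross a)) = code_uout table a
    & positive (cross a) = code_pos table a].
Proof. by rewrite /code_uin /code_uout /code_pos -tableE. Qed.

Lemma code_heightE (x : gen D) : height (val x).1 = code_height n (code_of_gen x).
Proof.
rewrite /height /code_height -card_ord_count; congr #|pred_of_set _|.
by apply/setP => a; rewrite !inE code_stateE.
Qed.

Lemma code_nposE : npos D = code_npos n table.
Proof.
rewrite /npos /code_npos -card_ord_count; congr #|pred_of_set _|.
by apply/setP => a; rewrite !inE; case: (code_crossE a) => _ _ ->.
Qed.

Lemma code_nnegE : nneg D = code_nneg n table.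
Proof.
rewrite /nneg /code_nneg -card_ord_count; congr #|pred_of_set _|.
by apply/setP => a; rewrite !inE; case: (code_crossE a) => _ _ ->.
Qed.

(** [roots] selects an unspecified arc in each class; a function constant on
    classes may be summed over the least arcs instead. *)
Lemma sum_roots (T : zmodType) k (r : rel 'I_k) (F : 'I_k -> T) :
    connect_sym r -> (forall e f, connect r e f -> F e = F f) ->
  \sum_(e in roots r) F e
    = \sum_(e | [forall f, connect r e f ==> (e <= f)%N]) F e.
Proof.
move=> r_sym F_const.
pose least e := [arg min_(f < e | connect r e f) (f : nat)].
have leastP e : connect r e (least e) /\
    forall f, connect r e f -> (least e <= f)%N.
  by rewrite /least; case: arg_minnP => [|f]; first exact: connect0.
rewrite (reindex_onto (fingraph.root r) least) => [|e /eqP re]; last first.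
  by rewrite -[RHS]re; apply/eqP; rewrite root_connect // r_sym (leastP e).1.
apply: eq_big => [e | e _]; last by rewrite -(F_const e) ?connect_root.
rewrite [_ \in _]roots_root //=; have [c_least least_le] := leastP (fingraph.root r e).
have sameE f : connect r (fingraph.root r e) f = connect r e f.
  exact/esym/(same_connect r_sym)/connect_root.
apply/eqP/forallP => [<- f | e_le].
  by apply/implyP => c_f; apply: least_le; apply: connect_trans c_least c_f.
apply/val_inj/eqP; rewrite eqn_leq least_le ?sameE ?connect0 //=.
by apply: (implyP (e_le _)); rewrite -sameE.
Qed.

Lemma code_label_degreeE (x : gen D) :
  label_degree x = code_label_degree m (code_of_gen x).
Proof.
rewrite /label_degree sum_roots; last first.
- move=> e f; have /forallP/(_ e)/forallP/(_ f)/implyP := valP x.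
  by move=> xef ef; rewrite (eqP (xef ef)).
- exact: same_circle_sym.
rewrite /code_label_degree -sumz_ord; apply: eq_big => [e | e _]; last first.
  by rewrite code_labelE.
rewrite nth_code_circles; apply/forallP/allP => [le f | le f]; last first.
  by apply/implyP => ef; apply: le; rewrite -same_circleE.
by case/mem_code_circle=> g <- eg; apply: (implyP (le g)).
Qed.

Lemma code_bidegreeE (x : gen D) : bidegree x = code_bidegree n m table (code_of_gen x).
Proof.
by rewrite /bidegree code_heightE code_label_degreeE code_nposE code_nnegE.
Qed.

Lemma code_incidenceE (x y : gen D) :
  incidence x y = code_incidence n m table (code_of_gen x) (code_of_gen y).
Proof.
rewrite /incidence /code_incidence -sumz_ord; apply: eq_big => [a | a _].
  congr (_ && _).
    rewrite /cube_edge /code_edge -!code_stateE; congr [&& _, _ & _].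
    by rewrite -all_ord; apply: eq_forallb => b; rewrite -!code_stateE.
  rewrite /unchanged_elsewhere /code_unchanged -all_ord.
  apply: eq_forallb => e; have [<- <- _] := code_crossE a.
  by rewrite -!code_sameE -!code_labelE.
congr (_ * _).
  rewrite /edge_sign /code_sign -card_ord_count -signr_odd.
  under eq_finset => b do rewrite code_stateE.
  by case: (odd _).
rewrite /local_coef /code_local; have [<- <- _] := code_crossE a.
by rewrite -!code_sameE -!code_labelE.
Qed.
End ModelCorrect.

Definition dot_product (r s : seq int) : int := sumz [seq p.1 * p.2 | p <- zip r s].

(** Besides the validity of the circles and the absence of repetitions: the
    differential has bidegree [(1, 0)] and squares to zero.  Rows and columns of
    its matrix are tabulated before they are multiplied. *)
Definition code_complex (n m : nat) (table : seq crossing_code) : bool :=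
  let gens := code_gens n m table in
  let cols := [seq [seq code_incidence n m table c d | c <- gens] | d <- gens] in
  [&& all (code_circle_closed n m table) (bits n), uniq gens,
      all (fun c => all (fun d => (code_incidence n m table c d == 0)
        || (code_bidegree n m table d == next_bideg (code_bidegree n m table c)))
        gens) gens
    & all (fun c => let row := [seq code_incidence n m table c d | d <- gens] in
        all (fun col => dot_product row col == 0) cols) gens].

(** [k!] times the value of [v_k] at [t = -1], [x = 1], computed on generators. *)
Definition code_euler (n m : nat) (table : seq crossing_code) (k : nat) : int :=
  sumz [seq (let p := code_bidegree n m table c in
             if odd `|p.1|%N then - p.2 ^+ k else p.2 ^+ k)
    | c <- code_gens n m table].

Lemma exp_coef_sign (i j : int) (k : nat) :
  exp_coef j k * (-1) ^ i = (if odd `|i|%N then - j ^+ k else j ^+ k)%:~R / k`!%:R.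
Proof.
rewrite /exp_coef mulrAC; congr (_ / _).
have -> : (-1) ^ i = (-1) ^+ odd `|i|%N :> rat.
  rewrite signr_odd; case: i => // k'.
  by rewrite NegzE -exprz_inv invrN1 abszN.
by case: odd; rewrite ?mulrN1 ?mulr1 ?rmorphN rmorphXn.
Qed.

Section ModelHomology.
Variables (D : link_diagram) (table : seq crossing_code).
Local Notation n := (ncross D).
Local Notation m := (narcs D).
Local Notation gens := (code_gens n m table).
Hypothesis tableE :
  forall a : 'I_n, code_of_crossing (cross a) = code_cross table a.
Hypothesis table_ok : code_complex n m table.

Let circle_closed : all (code_circle_closed n m table) (bits n).
Proof. by case/and4P: table_ok. Qed.

Let gens_uniq : uniq gens.
Proof. by case/and4P: table_ok. Qed.

Let mem_gens (x : gen D) : code_of_gen table x \in gens.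
Proof. by apply/(code_gensP tableE circle_closed); exists x. Qed.

Lemma code_diff_bideg (x y : gen D) :
  incidence x y != 0 -> bidegree y = next_bideg (bidegree x).
Proof.
rewrite (code_incidenceE tableE circle_closed) !(code_bidegreeE tableE circle_closed).
have /and4P[_ _ /allP/(_ _ (mem_gens x))/allP/(_ _ (mem_gens y)) + _] := table_ok.
by move=> + /negPf xy; rewrite xy => /eqP.
Qed.

Lemma code_diff_diff (x z : gen D) : \sum_y incidence x y * incidence y z = 0.
Proof.
under eq_bigr => y _ do rewrite !(code_incidenceE tableE circle_closed).
pose F c := code_incidence n m table (code_of_gen table x) c
  * code_incidence n m table c (code_of_gen table z).
rewrite (sum_code_gens tableE circle_closed F gens_uniq).
have /and4P[_ _ _ /allP/(_ _ (mem_gens x))/allP] := table_ok.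
move/(_ _ (map_f _ (mem_gens z)))/eqP; apply: etrans.
by rewrite /dot_product zip_map -map_comp /sumz foldrE big_map.
Qed.

Lemma kh_v_eval_code k :
  laurent_eval (kh_v k D) (-1) 1 = (code_euler n m table k)%:~R / k`!%:R.
Proof.
rewrite (kh_v_euler code_diff_bideg code_diff_diff).
under eq_bigr => x _ do rewrite exp_coef_sign (code_bidegreeE tableE circle_closed).
rewrite -mulr_suml -rmorph_sum /=; congr (_%:~R / _).
pose F c := let p := code_bidegree n m table c in
  if odd `|p.1|%N then - p.2 ^+ k else p.2 ^+ k.
rewrite (sum_code_gens tableE circle_closed F gens_uniq).
by rewrite /code_euler /sumz foldrE big_map.
Qed.

Lemma card_bidegree_code p :
  #|[pred x : gen D | bidegree x == p]|
    = count (fun c => code_bidegree n m table c == p) gens.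
Proof.
rewrite -sum1_card -sum1_count big_mkcond [RHS]big_mkcond /=.
rewrite -(sum_code_gens tableE circle_closed _ gens_uniq).
by apply: eq_bigr => x _; rewrite inE (code_bidegreeE tableE circle_closed).
Qed.

(** The evaluation-ready form of [zrank_isolated]. *)
Lemma mcoeff_kh_v_isolated k r p :
    [seq count (fun c => code_bidegree n m table c == q) gens
      | q <- [:: prev_bideg p; p; next_bideg p]] = [:: 0; r; 0]%N ->
  (kh_v k D)@_p = r%:R * exp_coef p.2 k.
Proof.
move=> [prev0 <- next0]; rewrite -card_bidegree_code.
rewrite (mcoeff_kh_v code_diff_bideg code_diff_diff).
by rewrite (zrank_isolated code_diff_bideg code_diff_diff) ?card_bidegree_code.
Qed.

End ModelHomology.

(** * Khovanov homology of the figure-eight knot and of the unknot *)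

(** Along the knot the crossings are met in the order 0 1 2 3 1 0 3 2, starting
    with an overpassage and alternating from then on. *)
Definition fig8_passage_nat (a : nat) (over : bool) : nat :=
  if over then nth 0%N [:: 0; 4; 2; 6]%N a else nth 0%N [:: 5; 1; 7; 3]%N a.

Definition fig8_passage (q : 'I_4 * bool) : 'I_4.*2 :=
  inord (fig8_passage_nat q.1 q.2) : 'I_8.

Lemma val_fig8_passage q : fig8_passage q = fig8_passage_nat q.1 q.2 :> nat.
Proof.
by case: q => [[[|[|[|[|//]]]] ?] []]; rewrite /fig8_passage inordK.
Qed.

Lemma fig8_passage_inj : injective fig8_passage.
Proof.
move=> q r /(congr1 (@nat_of_ord _)); rewrite !val_fig8_passage.
case: q r => [[a a4] b] [[c c4] d] /=.
case: a c a4 c4 => [|[|[|[|//]]]] [|[|[|[|//]]]] a4 c4;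
case: b; case: d => //= _; congr (_, _); exact: val_inj.
Qed.

Definition fig8 : gauss_diagram :=
  GaussDiagram (fun a : 'I_4 => (a < 2)%N) fig8_passage_inj.

Definition fig8_table : seq crossing_code :=
  [:: (4, 5, 7, 0, true); (0, 1, 3, 4, true);
      (6, 7, 1, 2, false); (2, 3, 5, 6, false)]%N.

(** Arc [k] leaves passage [k], so the arc entering it is [k - 1] modulo 8. *)
Lemma fig8_tableE (a : 'I_4) :
  code_of_crossing (@cross (link_of_gauss fig8) a) = code_cross fig8_table a.
Proof.
have outE (k : 'I_4.*2) : out_arc k = k :> nat by rewrite /out_arc inordK.
have inE (k : 'I_4.*2) : in_arc k = ((k + 8).-1 %% 8)%N :> nat by rewrite /= outE.
transitivity (in_arc (fig8_passage (a, false)) : nat,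
  out_arc (fig8_passage (a, false)) : nat, in_arc (fig8_passage (a, true)) : nat,
  out_arc (fig8_passage (a, true)) : nat, (a < 2)%N); first by [].
rewrite !outE !inE !val_fig8_passage.
by case: a => [[|[|[|[|//]]]] ?].
Qed.

Lemma fig8_complex : code_complex 4 8 fig8_table.
Proof. by vm_compute. Qed.

Lemma unknot_complex : code_complex 0 1 [::].
Proof. by vm_compute. Qed.

Lemma kh_v_fig8_eval : laurent_eval (kh_v 3 (link_of_gauss fig8)) (-1) 1 = 0.
Proof.
rewrite (@kh_v_eval_code (link_of_gauss fig8) _ fig8_tableE fig8_complex).
rewrite [code_euler _ _ _ _](_ : _ = 0); first by rewrite mul0r.
by vm_compute.
Qed.

Lemma unknot_tableE (a : 'I_0) :
  code_of_crossing (@cross (link_of_gauss unknot_diagram) a) = code_cross [::] a.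
Proof. by case: a. Qed.

Lemma kh_v_unknot_eval :
  laurent_eval (kh_v 3 (link_of_gauss unknot_diagram)) (-1) 1 = 0.
Proof.
rewrite (@kh_v_eval_code (link_of_gauss unknot_diagram) _ unknot_tableE unknot_complex).
rewrite [code_euler _ _ _ _](_ : _ = 0); first by rewrite mul0r.
by vm_compute.
Qed.

(** At the vertex where every crossing is 1-smoothed there are three circles; the
    only generator of bidegree [(2, 5)] labels them all [v_+]. *)
Lemma mcoeff_kh_v_fig8 :
  (kh_v 3 (link_of_gauss fig8))@_(2, 5) = 1%:R * exp_coef 5 3.
Proof.
apply: (@mcoeff_kh_v_isolated (link_of_gauss fig8) _ fig8_tableE fig8_complex).
by vm_compute.
Qed.

Lemma mcoeff_kh_v_unknot :
  (kh_v 3 (link_of_gauss unknot_diagram))@_(2, 5) = 0%:R * exp_coef 5 3.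
Proof.
apply: (@mcoeff_kh_v_isolated (link_of_gauss unknot_diagram) _ unknot_tableE
  unknot_complex).
by vm_compute.
Qed.

Lemma kh_v_fig8_neq :
  kh_v 3 (link_of_gauss fig8) <> kh_v 3 (link_of_gauss unknot_diagram).
Proof.
move=> kh_eq; pose coef (P : laurent) := P@_(2, 5).
have : 0%:R * exp_coef 5 3 = 1%:R * exp_coef 5 3.
  apply: (etrans (esym mcoeff_kh_v_unknot)).
  exact: (etrans (congr1 coef (esym kh_eq)) mcoeff_kh_v_fig8).
have /eqP e0 : exp_coef 5 3 != 0 by rewrite mulf_neq0 ?expf_neq0.
rewrite mul0r mul1r => /esym; exact: e0.
Qed.

(** * A polygonal figure-eight knot *)

Section Fig8Polygon.
Variable R : realType.

(** Coordinate [j] of vertex [k] of a heptagon.  Edges 1, 2, 3, 4 and 6 cross: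
    edge 1 with 4, edge 2 with 4 and with 6, and edge 3 with 6; the altitudes are
    chosen so that the diagram alternates. *)
Definition fig8_coord (j k : nat) : R :=
  (nth 0 (nth [::] [:: [:: 6; 5; 4; 4; 3; 6; 1];
                       [:: 4; 2; 2; 4; 3; 1; 3];
                       [:: 1; 4; 0; 3; 0; 2; 4]] j) k)%N%:R.

Definition fig8_vert (k : 'I_7) : 'rV[R]_3 := \row_(j < 3) fig8_coord j k.

Definition edge_coord (j k : nat) : R := fig8_coord j (k.+1 %% 7)%N - fig8_coord j k.

Lemma edge_dirE k j : edge_dir fig8_vert k 0 j = edge_coord j k.
Proof. by rewrite !mxE. Qed.

Lemma point_atE q j :
  point_at fig8_vert q 0 j = fig8_coord j q.1 + q.2 * edge_coord j q.1.
Proof. by rewrite !mxE. Qed.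

(** The edges and the parameters on them at the eight passages, in order. *)
Definition fig8_theta (i : 'I_8) : param R 7 :=
  (inord (nth 0 [:: 1; 2; 2; 3; 4; 4; 6; 6] i)%N,
   nth 0 [:: 1 / 2; 1 / 6; 4 / 5; 1 / 2; 1 / 3; 1 / 2; 1 / 2; 3 / 5] i).

Lemma fig8_thetaE (i : 'I_8) (q : param R 7) :
    q.1 = nth 0%N [:: 1; 2; 2; 3; 4; 4; 6; 6]%N i :> nat ->
    q.2 = nth 0 [:: 1 / 2; 1 / 6; 4 / 5; 1 / 2; 1 / 3; 1 / 2; 1 / 2; 3 / 5] i ->
  q = fig8_theta i.
Proof.
by case: q => k s /= kE ->; congr (_, _); apply: val_inj; rewrite -kE inord_val.
Qed.

Lemma theta_edge i : (fig8_theta i).1 = nth 0%N [:: 1; 2; 2; 3; 4; 4; 6; 6]%N i :> nat.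
Proof. by case: i => [[|[|[|[|[|[|[|[|//]]]]]]]] ?]; rewrite /fig8_theta inordK. Qed.

Definition crossing_pair (q r : param R 7) : Prop :=
  exists a b, q = fig8_theta (fig8_passage (a, b)) /\
              r = fig8_theta (fig8_passage (a, ~~ b)).

Lemma crossing_pair_sym q r : crossing_pair q r -> crossing_pair r q.
Proof. by case=> a [b [qE rE]]; exists a, (~~ b); rewrite negbK. Qed.

Lemma planar_projP q r :
  planar_proj (point_at fig8_vert q) = planar_proj (point_at fig8_vert r) <->
  forall j, (j < 2)%N -> fig8_coord j q.1 + q.2 * edge_coord j q.1
                       = fig8_coord j r.1 + r.2 * edge_coord j r.1.
Proof.
rewrite /planar_proj !point_atE; split=> [[x y] [|[|//]] | qr] //.
by congr (_, _); apply: qr.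
Qed.

Lemma fig8_theta01 i : 0 < (fig8_theta i).2 < 1.
Proof. by case: i => [[|[|[|[|[|[|[|[|//]]]]]]]] ?]; rewrite /fig8_theta /=;
  apply/andP; split; lra. Qed.

Lemma fig8_theta_lt (i j : 'I_8) : (i < j)%N -> param_lt (fig8_theta i) (fig8_theta j).
Proof.
rewrite /param_lt -(inj_eq val_inj) /= !theta_edge.
case: i => [[|[|[|[|[|[|[|[|//]]]]]]]] ?];
case: j => [[|[|[|[|[|[|[|[|//]]]]]]]] ?] //= _; lra.
Qed.

Lemma fig8_crossing_proj q r : crossing_pair q r ->
  planar_proj (point_at fig8_vert q) = planar_proj (point_at fig8_vert r).
Proof.
case=> a [b [-> ->]]; apply/planar_projP => j j2.
rewrite !theta_edge !val_fig8_passage /= !val_fig8_passage.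
rewrite /edge_coord /fig8_coord.
case: a => [[|[|[|[|//]]]] ?]; case: b; case: j j2 => [|[|//]] _ /=; lra.
Qed.

(** Two edges give two linear equations in two unknowns of [0, 1[.  For an edge
    and itself these force equal parameters; for the four pairs of crossing
    edges there is one solution, and for all other pairs there is none. *)
Lemma fig8_double_point q r : param_ok q -> param_ok r -> q <> r ->
    planar_proj (point_at fig8_vert q) = planar_proj (point_at fig8_vert r) ->
  crossing_pair q r.
Proof.
wlog le_qr : q r / (q.1 <= r.1)%N.
  have [le W | /ltnW le W q_ok r_ok neq proj] := leqP q.1 r.1; first exact: W.
  by apply/crossing_pair_sym/W => // rq; apply: neq.
move=> /andP[q0 q1] /andP[r0 r1] neq /planar_projP proj.
have {neq} neq : q.1 = r.1 :> nat -> q.2 <> r.2.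
  by move=> /val_inj e1 e2; apply: neq; apply: injective_projections.
have := proj 0%N isT; have := proj 1%N isT; move=> {proj}.
rewrite /edge_coord /fig8_coord.
case: q r le_qr q0 q1 r0 r1 neq => [[k k7] s] [[l l7] t] /=.
case: k k7 => [|[|[|[|[|[|[|//]]]]]]] k7;
case: l l7 => [|[|[|[|[|[|[|//]]]]]]] l7 //= _ s0 s1 t0 t1 neq y x.
(* Two edges without common point in the projection. *)
all: try (exfalso; lra).
(* An edge and itself. *)
all: try (case: (neq erefl); lra).
- exists (Ordinal (isT : (0 < 4)%N)), true.
  by split; apply: fig8_thetaE; rewrite val_fig8_passage //=; lra.
- exists (Ordinal (isT : (1 < 4)%N)), false.
  by split; apply: fig8_thetaE; rewrite val_fig8_passage //=; lra.
- exists (Ordinal (isT : (2 < 4)%N)), true.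
  by split; apply: fig8_thetaE; rewrite val_fig8_passage //=; lra.
- exists (Ordinal (isT : (3 < 4)%N)), false.
  by split; apply: fig8_thetaE; rewrite val_fig8_passage //=; lra.
Qed.

Lemma fig8_altitude a :
  altitude (point_at fig8_vert (fig8_theta (fig8_passage (a, false))))
  < altitude (point_at fig8_vert (fig8_theta (fig8_passage (a, true)))).
Proof.
rewrite /altitude !point_atE !theta_edge /= !val_fig8_passage /=.
rewrite /edge_coord /fig8_coord.
by case: a => [[|[|[|[|//]]]] ?] /=; lra.
Qed.

Lemma fig8_sign (a : 'I_4) :
  let d := planar_det
    (edge_dir fig8_vert (fig8_theta (fig8_passage (a, true))).1)
    (edge_dir fig8_vert (fig8_theta (fig8_passage (a, false))).1) in
  if (a < 2)%N then 0 < d else d < 0.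
Proof.
rewrite /planar_det !edge_dirE !theta_edge !val_fig8_passage /=.
rewrite /edge_coord /fig8_coord.
by case: a => [[|[|[|[|//]]]] ?] /=; lra.
Qed.

(** Points with the same projection are separated by their altitudes. *)
Lemma fig8_simple : simple_closed fig8_vert.
Proof.
move=> q r q_ok r_ok qr; apply: contrapT => neq.
have [a [b [qE rE]]] := fig8_double_point q_ok r_ok neq (congr1 (@planar_proj R) qr).
have := fig8_altitude a; move: qr; rewrite qE rE.
by case: b {qE rE} => ->; rewrite ltxx.
Qed.

Definition fig8_knot : knot R := Knot (isT : (0 < 7)%N) fig8_simple.

Lemma fig8_is_diagram : is_diagram fig8_knot fig8.
Proof.
exists fig8_theta; split.
- exact: fig8_theta01.
- exact: fig8_theta_lt.
- move=> q r q_ok r_ok neq; split; first exact: fig8_double_point.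
  exact: fig8_crossing_proj.
- exact: fig8_altitude.
exact: fig8_sign.
Qed.

End Fig8Polygon.

Theorem mainTheorem2 (R : realType) :
  exists (K2 : knot R) (D2 : gauss_diagram),
    is_diagram K2 D2 /\
    laurent_eval (kh_v 3 (link_of_gauss D2)) (-1) 1
      = laurent_eval (kh_v 3 (link_of_gauss unknot_diagram)) (-1) 1 /\
    kh_v 3 (link_of_gauss D2) <> kh_v 3 (link_of_gauss unknot_diagram).
Proof.
exists (fig8_knot R), fig8; split; first exact: fig8_is_diagram.
split; last exact: kh_v_fig8_neq.
exact: etrans kh_v_fig8_eval (esym kh_v_unknot_eval).
Qed.
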